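(* Let $T_1$ and $T_2$ be two $2\times 2$ contingency tables. Simpson's paradox holds for $T_1$ and $T_2$ if and only if $$\bigl((\kappa(T_1)>1)\wedge(\kappa(T_2)>1)\wedge\neg(\kappa(T_1+T_2)>1)\bigr)\ \vee\ \bigl((\kappa(T_1)<1)\wedge(\kappa(T_2)<1)\wedge\neg(\kappa(T_1+T_2)<1)\bigr).$$
   Context: A $2\times 2$ contingency table $T=\begin{pmatrix} a & b\\ c& d\end{pmatrix}$ has entries that are positive real numbers; its odds ratio is $\kappa(T)=(ad)/(bc)$. For two such tables $T_i=\begin{pmatrix} a_i & b_i\\ c_i& d_i\end{pmatrix}$, $i=1,2$, the aggregated table $T_1+T_2$ is the entrywise sum. Put $A_i=\frac{a_i}{a_i+b_i}$, $C_i=\frac{c_i}{c_i+d_i}$ for $i=1,2$, and $\mu=\frac{a_1+a_2}{a_1+b_1+a_2+b_2}$, $\nu=\frac{c_1+c_2}{c_1+d_1+c_2+d_2}$. Simpson's paradox (SP) is said to occur (hold) for $T_1$ and $T_2$ if at least one of the following holds: (SP$_1$) $A_1>C_1$ and $A_2>C_2$ and not $(\mu>\nu)$; (SP$_2$) $A_1<C_1$ and $A_2<C_2$ and not $(\mu<\nu)$. *)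

(* Defs.v *)
From Stdlib Require Import Reals.
Open Scope R_scope.

(* [mkTable a b c d _ _ _ _] is the table with rows (a, b) and (c, d). *)
Record table : Type := mkTable {
  ta : R;
  tb : R;
  tc : R;
  td : R;
  ta_pos : 0 < ta;
  tb_pos : 0 < tb;
  tc_pos : 0 < tc;
  td_pos : 0 < td
}.

Definition odds_ratio (T : table) : R := (ta T * td T) / (tb T * tc T).

Definition table_add (T1 T2 : table) : table :=
  mkTable (ta T1 + ta T2) (tb T1 + tb T2) (tc T1 + tc T2) (td T1 + td T2)
    (Rplus_lt_0_compat _ _ (ta_pos T1) (ta_pos T2))
    (Rplus_lt_0_compat _ _ (tb_pos T1) (tb_pos T2))
    (Rplus_lt_0_compat _ _ (tc_pos T1) (tc_pos T2))
    (Rplus_lt_0_compat _ _ (td_pos T1) (td_pos T2)).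

Definition rateA (T : table) : R := ta T / (ta T + tb T).
Definition rateC (T : table) : R := tc T / (tc T + td T).

Definition mu (T1 T2 : table) : R :=
  (ta T1 + ta T2) / (ta T1 + tb T1 + ta T2 + tb T2).
Definition nu (T1 T2 : table) : R :=
  (tc T1 + tc T2) / (tc T1 + td T1 + tc T2 + td T2).

Definition SP1 (T1 T2 : table) : Prop :=
  rateA T1 > rateC T1 /\ rateA T2 > rateC T2 /\ ~ (mu T1 T2 > nu T1 T2).

Definition SP2 (T1 T2 : table) : Prop :=
  rateA T1 < rateC T1 /\ rateA T2 < rateC T2 /\ ~ (mu T1 T2 < nu T1 T2).

Definition simpson_paradox (T1 T2 : table) : Prop := SP1 T1 T2 \/ SP2 T1 T2.

(* Main.v *)
(* Each comparison of success rates and each comparison of an odds ratio with 1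
   is, after clearing denominators, the same comparison of a*d with b*c; the
   aggregated rates mu and nu are the rates of the aggregated table. *)
Require Import Defs.
From Stdlib Require Import Reals Lra.
Open Scope R_scope.

Lemma Rdiv_lt_cross (x y u v : R) :
  0 < y -> 0 < v -> (x / y < u / v <-> x * v < u * y).
Proof.
  intros Hy Hv.
  (* Each product is its quotient scaled by the common positive factor [y * v]. *)
  replace (x * v) with (x / y * (y * v)) by (field; lra).
  replace (u * y) with (u / v * (y * v)) by (field; lra).
  assert (Hyv : 0 < y * v) by now apply Rmult_lt_0_compat.
  split; intro H.
  - now apply Rmult_lt_compat_r.
  - now apply Rmult_lt_reg_r with (y * v).
Qed.

Lemma odds_ratio_gt1 (T : table) : odds_ratio T > 1 <-> rateA T > rateC T.
Proof.
  destruct T as [a b c d Ha Hb Hc Hd]; unfold odds_ratio, rateA, rateC; simpl.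
  assert (Hbc : 0 < b * c) by now apply Rmult_lt_0_compat.
  (* Reading 1 as [1 / 1] lets cross-multiplication apply to both comparisons. *)
  unfold Rgt; rewrite <- Rdiv_1_r at 1.
  rewrite !Rdiv_lt_cross by lra.
  (* Expanding [c * (a + b) < a * (c + d)], the shared [a * c] cancels; the rest is linear in the
     monomials. *)
  split; intro H; lra.
Qed.

Lemma odds_ratio_lt1 (T : table) : odds_ratio T < 1 <-> rateA T < rateC T.
Proof.
  destruct T as [a b c d Ha Hb Hc Hd]; unfold odds_ratio, rateA, rateC; simpl.
  assert (Hbc : 0 < b * c) by now apply Rmult_lt_0_compat.
  rewrite <- (Rdiv_1_r 1).
  rewrite !Rdiv_lt_cross by lra.
  split; intro H; lra.
Qed.

Lemma rateA_table_add (T1 T2 : table) : rateA (table_add T1 T2) = mu T1 T2.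
Proof. unfold rateA, mu; simpl; f_equal; ring. Qed.

Lemma rateC_table_add (T1 T2 : table) : rateC (table_add T1 T2) = nu T1 T2.
Proof. unfold rateC, nu; simpl; f_equal; ring. Qed.

Theorem theorem3 (T1 T2 : table) :
  simpson_paradox T1 T2 <->
  ((odds_ratio T1 > 1 /\ odds_ratio T2 > 1 /\
      ~ (odds_ratio (table_add T1 T2) > 1)) \/
   (odds_ratio T1 < 1 /\ odds_ratio T2 < 1 /\
      ~ (odds_ratio (table_add T1 T2) < 1))).
Proof.
  rewrite !odds_ratio_gt1, !odds_ratio_lt1, rateA_table_add, rateC_table_add.
  (* The right side is now [simpson_paradox] unfolded. *)
  reflexivity.
Qed.
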